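(* For every pattern $\tau\in\{12312,\,12132,\,12123,\,12321,\,12231,\,12213\}$ and every $n\ge1$, the number of matchings on $[2n]$ avoiding $\tau$ equals $C_{n,3}=\frac{1}{2n+1}\binom{3n}{n}$.
   Context: A matching on $[2n]$ is a partition of $[2n]$ into $n$ blocks of size two (edges). The canonical sequential form of a matching with $n$ edges is the word of length $2n$ obtained by labeling edges $1,\dots,n$ in increasing order of their smaller elements and writing at each position the label of the edge containing it. Words $a_1\cdots a_k$, $b_1\cdots b_k$ are order-isomorphic if $a_i<a_j\iff b_i<b_j$ for all $i,j$. A matching contains a pattern $\tau$ if its canonical sequential form has a subsequence order-isomorphic to $\tau$, and avoids $\tau$ otherwise. *)

(* Defs.v *)
From mathcomp Require Import all_boot all_order all_algebra.

Set Implicit Arguments.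
Unset Strict Implicit.
Unset Printing Implicit Defensive.

(* The ground set [2n] = {1, ..., 2n} is represented by 'I_(2 * n), with      *)
(* i : 'I_(2 * n) standing for i + 1.                                         *)
Definition is_matching (n : nat) (M : {set {set 'I_(2 * n)}}) : bool :=
  partition M [set: 'I_(2 * n)] && [forall (B | B \in M), #|B| == 2].

(* The default value m is never reached when B is nonempty. *)
Definition set_min (m : nat) (B : {set 'I_m}) : nat :=
  \big[minn/m]_(i in B) (i : nat).

(* Rank of the edge B when the edges of M are numbered 1, 2, ... in           *)
(* increasing order of their smaller elements; B itself is counted.           *)
Definition edge_label (m : nat) (M : {set {set 'I_m}}) (B : {set 'I_m}) : nat :=
  #|[set B' in M | set_min B' <= set_min B]|.

Definition canonical_form (m : nat) (M : {set {set 'I_m}}) : seq nat :=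
  [seq edge_label M (pblock M i) | i <- enum 'I_m].

Definition order_iso (a b : seq nat) : bool :=
  (size a == size b) &&
  [forall i : 'I_(size a), forall j : 'I_(size a),
     (nth 0 a i < nth 0 a j) == (nth 0 b i < nth 0 b j)].

(* The subsequences of w are the words mask s w for s : (size w).-tuple bool. *)
Definition word_contains (w tau : seq nat) : bool :=
  [exists s : (size w).-tuple bool, order_iso (mask s w) tau].

Definition matching_avoids (m : nat) (M : {set {set 'I_m}}) (tau : seq nat)
    : bool :=
  ~~ word_contains (canonical_form M) tau.

Definition avoiding_matchings (n : nat) (tau : seq nat)
    : {set {set {set 'I_(2 * n)}}} :=
  [set M | is_matching M && matching_avoids M tau].

(* Main.v *)
Require Import Defs.
From mathcomp Require Import all_boot all_order all_algebra zify.

(** Every pattern contains the letter 3 once, so write it u 3 v with u and v in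
    the letters 1, 2.  A canonical word with n + 1 edges arises from one with n
    edges by inserting the new largest letter N twice, at two gaps p <= q that lie
    after all first occurrences.  Being largest, N can only play the role of 3;
    hence the new word avoids the pattern iff the old one does and neither p nor q
    is a gap with some copy of u to its left and the matching copy of v to its
    right.  Call the remaining gaps open.

    For each of the six patterns, among the choices p <= q of two of the K open
    gaps exactly K - d produce a word with d + 2 open gaps (d < K), although the
    correspondence differs from pattern to pattern.  So all six classes have the
    same generating tree, and the number of its nodes at level n having k + 1 open
    gaps is the coefficient of z^(n - k) in T^(2k), where T = 1 + z T^3.  Summing
    over k gives the coefficient of z^n in T. *)

Set Implicit Arguments.
Unset Strict Implicit.
Unset Printing Implicit Defensive.

Import Order.TTheory.

(** * Powers of the ternary tree series *)

(* [raney j r] is the coefficient of z^j in T^r, where T = 1 + z T^3; the recursion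
   is T^(r+1) = T^r + z T^(r+3). *)
Fixpoint raney (j : nat) : nat -> nat :=
  match j with
  | 0 => fun=> 1
  | j'.+1 => fix rj r := if r is r'.+1 then rj r' + raney j' r.+2 else 0
  end.

Lemma raneySS j r : raney j.+1 r.+1 = raney j.+1 r + raney j r.+3.
Proof. by []. Qed.

(* T = 1 / (1 - z T^2). *)
Lemma raney_step m r : raney m r.+1 = \sum_(t < m.+1) raney (m - t) (r + 2 * t).
Proof.
elim: m r => [|m IHm] r; first by rewrite big_ord1.
rewrite raneySS big_ord_recl subn0 addn0 IHm; congr (_ + _).
by apply: eq_bigr => t _; rewrite lift0 subSS; congr raney; lia.
Qed.

(** This is T^2 = 1 / (1 - z T^2)^2; the weights t + 1 of its expansion are the multiplicities K - d
    of the generating tree. *)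
Lemma raney_step2 m r :
  raney m r.+2 = \sum_(t < m.+1) t.+1 * raney (m - t) (r + 2 * t).
Proof.
elim: m r => [|m IHm] r; first by rewrite big_ord1.
rewrite 2!raneySS big_ord_recl subn0 addn0 mul1n -addnA; congr (_ + _).
rewrite (IHm r.+2) (raney_step m r.+2) addnC -big_split; apply: eq_bigr => t _.
rewrite lift0 subSS [in RHS]mulSn.
by rewrite (_ : r + 2 * t.+1 = r.+2 + 2 * t) /= 1?addnC //; lia.
Qed.

(** A ballot-type closed form, stated additively to avoid truncated subtraction. By Pascal's rule
    the difference of the two binomials obeys the recursion of [raney]. *)
Lemma raney_binE j r :
  raney j.+1 r.+1 + 2 * 'C(3 * j.+1 + r, j) = 'C(3 * j.+1 + r, j.+1).
Proof.
elim: j r => [|j IHj] r.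
  by rewrite bin0 bin1; elim: r => [|r IHr] //; rewrite raneySS [raney 0 _]/=; lia.
elim: r => [|r IHr].
  (* The same formula for T^0, whose coefficient of z^(j + 2) is 0; it starts the recursion on the
     exponent. *)
  have b0 : 'C((3 * j.+2).-1, j.+2) = 2 * 'C((3 * j.+2).-1, j.+1).
    apply/eqP; rewrite -(eqn_pmul2l (isT : 0 < j.+2)) mul_bin_left.
    by apply/eqP; rewrite (_ : _ - _ = j.+2 * 2) ?mulnA //; lia.
  have := IHj 2; rewrite (raneySS j.+1) addn0.
  rewrite (_ : 3 * j.+2 = (3 * j.+1 + 2).+1) in b0 *; last by lia.
  by move: (3 * j.+1 + 2) b0 => m /= b0; rewrite !binS b0; lia.
have IHj3 := IHj r.+3; have e : 3 * j.+2 + r = 3 * j.+1 + r.+3 by lia.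
rewrite raneySS (addnS (3 * j.+2)) e; rewrite e in IHr.
by move: (3 * j.+1 + r.+3) IHr IHj3 => m IHr IHj3; rewrite !binS; lia.
Qed.

(** For n > 0, (2n + 1) C(3n, n - 1) = n C(3n, n), which eliminates the second binomial from
    [raney_binE]. *)
Lemma raney1 n : (2 * n + 1) * raney n 1 = 'C(3 * n, n).
Proof.
case: n => [|n]; first by rewrite bin0.
have := raney_binE n 0; rewrite addn0.
have := mul_bin_left (3 * n.+1) n; rewrite (_ : 3 * n.+1 - n = 2 * n.+1 + 1); last by lia.
nia.
Qed.

(** * Occurrences of a pattern with a single 3 *)

Definition inst (a b : nat) (s : seq nat) : seq nat :=
  [seq if i == 1 then a else b | i <- s].

Lemma order_iso_inst a b c u v :
    a < b -> b < c -> all [in [:: 1; 2]] u -> all [in [:: 1; 2]] v ->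
  order_iso (inst a b u ++ c :: inst a b v) (u ++ 3 :: v).
Proof.
move=> ab bc /allP u12 /allP v12.
pose h i := if i == 3 then c else if i == 1 then a else b.
have instE s : {subset s <= [:: 1; 2]} -> inst a b s = map h s.
  move=> s12; apply/eq_in_map => i /s12; rewrite !inE /h.
  by case/orP => /eqP ->.
rewrite !instE // -[c]/(h 3) -map_cons -map_cat.
have mem123 : {subset u ++ 3 :: v <= [:: 1; 2; 3]}.
  move=> i; rewrite mem_cat inE => /or3P [/u12|/eqP->|/v12]; rewrite ?inE //.
    by case/orP => ->; rewrite ?orbT.
  by case/orP => ->; rewrite ?orbT.
rewrite /order_iso size_map eqxx; apply/forallP => i; apply/forallP => j.
rewrite !(nth_map 0) //.
have /mem123 := mem_nth 0 (ltn_ord i); have /mem123 := mem_nth 0 (ltn_ord j).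
by rewrite !inE /h => /or3P [] /eqP -> /or3P [] /eqP -> /=; apply/eqP; lia.
Qed.

(** Equality is the absence of both strict inequalities, so order isomorphism preserves it too.
    Hence [t] is determined by its letters at the first positions of 1, 2 and 3 in the pattern. *)
Lemma order_iso_instP t u v :
    1 \in u -> 2 \in u -> all [in [:: 1; 2]] u -> all [in [:: 1; 2]] v ->
    order_iso t (u ++ 3 :: v) ->
  exists a b c, [/\ a < b, b < c & t = inst a b u ++ c :: inst a b v].
Proof.
move=> u1 u2 /allP u12 /allP v12 /andP [/eqP szt iso].
set tau := u ++ 3 :: v in szt iso.
have lt_iso i j : i < size tau -> j < size tau ->
    (nth 0 t i < nth 0 t j) = (nth 0 tau i < nth 0 tau j).
  rewrite -szt => it jt.
  by move/forallP/(_ (Ordinal it))/forallP/(_ (Ordinal jt))/eqP: iso.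
have eq_iso i j : i < size tau -> j < size tau ->
    nth 0 tau i = nth 0 tau j -> nth 0 t i = nth 0 t j.
  move=> it jt e; have := lt_iso i j it jt; have := lt_iso j i jt it.
  by rewrite e !ltnn; lia.
have tau1 : 1 \in tau by rewrite mem_cat u1.
have tau2 : 2 \in tau by rewrite mem_cat u2.
have tau3 : 3 \in tau by rewrite mem_cat inE eqxx orbT.
exists (nth 0 t (index 1 tau)), (nth 0 t (index 2 tau)), (nth 0 t (index 3 tau)).
split; rewrite ?lt_iso ?index_mem ?nth_index //.
have tauE i : i < size tau -> nth 0 t i = nth 0 t (index (nth 0 tau i) tau).
  move=> it; apply: eq_iso => //; last by rewrite nth_index // mem_nth.
  by rewrite index_mem mem_nth.
have {1}-> : t = [seq nth 0 t (index i tau) | i <- tau].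
  apply: (@eq_from_nth _ 0); first by rewrite size_map.
  by move=> i; rewrite szt => it; rewrite (nth_map 0) // tauE.
rewrite {2}/tau map_cat map_cons; congr (_ ++ _ :: _); apply/eq_in_map => i.
  by move/u12; rewrite !inE => /orP [] /eqP ->.
by move/v12; rewrite !inE => /orP [] /eqP ->.
Qed.

Lemma word_containsP w u v :
    1 \in u -> 2 \in u -> all [in [:: 1; 2]] u -> all [in [:: 1; 2]] v ->
  reflect (exists a b c, [/\ a < b, b < c &
             subseq (inst a b u ++ c :: inst a b v) w])
          (word_contains w (u ++ 3 :: v)).
Proof.
move=> u1 u2 u12 v12; apply: (iffP existsP) => [[s /order_iso_instP] | ].
  case=> // a [b [c [ab bc e]]]; exists a, b, c; split=> //.
  by rewrite -e mask_subseq.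
case=> a [b [c [ab bc /subseqP [m szm e]]]].
exists (tcast szm (in_tuple m)); rewrite val_tcast -e.
exact: order_iso_inst.
Qed.

(** Holds when a new largest letter between [x] and [y] would serve as the 3. Drawing a and b from
    [x] makes this a boolean and loses nothing when [u] contains both 1 and 2. *)
Definition blocked (u v x y : seq nat) : bool :=
  has (fun b => has (fun a =>
    [&& a < b, subseq (inst a b u) x & subseq (inst a b v) y]) x) x.

Lemma blockedP u v x y : 1 \in u -> 2 \in u ->
  reflect (exists a b, [/\ a < b, subseq (inst a b u) x & subseq (inst a b v) y])
          (blocked u v x y).
Proof.
move=> u1 u2; apply: (iffP hasP) => [[b _ /hasP [a _ /and3P []]] | ].
  by exists a, b.
case=> a [b [ab ux vy]].
have xb : b \in x.
  by apply: (mem_subseq ux); apply/mapP; exists 2.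
have xa : a \in x.
  by apply: (mem_subseq ux); apply/mapP; exists 1.
by exists b => //; apply/hasP; exists a => //; rewrite ab ux vy.
Qed.

Lemma subseq_insert (T : eqType) (N : T) s x y :
  N \notin s -> subseq s (x ++ N :: y) = subseq s (x ++ y).
Proof.
move=> Ns; have sN : all (predC1 N) s.
  by apply/allP => a sa /=; apply: contraNneq Ns => <-.
have filterE t : subseq s t = subseq s (filter (predC1 N) t).
  by rewrite subseq_filter sN.
by rewrite filterE [RHS]filterE !filter_cat /= eqxx.
Qed.

Lemma subseq_pivot (T : eqType) (N : T) u v x y : N \notin x -> N \notin u ->
  subseq (u ++ N :: v) (x ++ N :: y) =
  subseq u x && subseq v y || subseq (u ++ N :: v) (x ++ y).
Proof.
elim: x u => [|c x IHx] [|d u] Nx Nu.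
- rewrite /= eqxx; apply/idP/orP => [->|[//|]]; first by left.
  exact/subseq_trans/subseq_cons.
- by move: Nu; rewrite /= inE negb_or eq_sym => /andP [/negPf -> Nu].
- move: Nx; rewrite /= inE negb_or => /andP [/negPf -> Nx].
  by rewrite -[N :: v]/([::] ++ N :: v) IHx // sub0seq.
move: Nx; rewrite /= inE negb_or => /andP [_ Nx].
case: eqP => _; first by move: Nu; rewrite inE negb_or => /andP [_ Nu]; apply: IHx.
exact: (IHx (d :: u)).
Qed.

Lemma subseq_split (T : eqType) (N : T) u v x y :
    N \notin x -> N \notin y -> N \notin u ->
  subseq (u ++ N :: v) (x ++ N :: y) = subseq u x && subseq v y.
Proof.
move=> Nx Ny Nu; rewrite subseq_pivot // orbC; case: subseqP => // [[m _ e]].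
have : N \in x ++ y by apply: (mem_mask (m := m)); rewrite -e mem_cat mem_head orbT.
by rewrite mem_cat (negPf Nx) (negPf Ny).
Qed.

Lemma subseq_head (T : eqType) (N : T) v x y : N \notin x ->
  subseq (N :: v) (x ++ N :: y) = subseq v y.
Proof.
elim: x => [|c x IHx] /=; first by rewrite eqxx.
by rewrite inE negb_or => /andP [/negPf -> /IHx].
Qed.

Lemma subseq_head2 (T : eqType) (a N : T) v x y : N \notin x -> a \in x ->
  subseq (a :: N :: v) (x ++ N :: y) = subseq v y.
Proof.
elim: x => [|c x IHx] //.
rewrite !inE negb_or => /andP [Nc Nx] /=; case: eqP => [_ _|_ /= xa].
  exact: subseq_head.
exact: IHx.
Qed.

Lemma subseqN (T : eqType) (N : T) s x : N \in s -> N \notin x -> subseq s x = false.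
Proof. by move=> sN xN; apply: contraNF xN => /mem_subseq; apply. Qed.

(** * The six patterns *)

Variant pattern := P12312 | P12132 | P12123 | P12321 | P12231 | P12213.

Definition before3 (t : pattern) : seq nat :=
  match t with
  | P12312 | P12321 => [:: 1; 2]
  | P12132 => [:: 1; 2; 1]
  | P12123 => [:: 1; 2; 1; 2]
  | P12231 => [:: 1; 2; 2]
  | P12213 => [:: 1; 2; 2; 1]
  end.

Definition after3 (t : pattern) : seq nat :=
  match t with
  | P12312 => [:: 1; 2]
  | P12132 => [:: 2]
  | P12321 => [:: 2; 1]
  | P12231 => [:: 1]
  | P12123 | P12213 => [::]
  end.

Definition contains (t : pattern) (w : seq nat) : bool :=
  word_contains w (before3 t ++ 3 :: after3 t).

Notation obstructed t := (blocked (before3 t) (after3 t)).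

Lemma containsP t w :
  reflect (exists a b c, [/\ a < b, b < c &
             subseq (inst a b (before3 t) ++ c :: inst a b (after3 t)) w])
          (contains t w).
Proof. by apply: word_containsP; case: t. Qed.

Lemma obstructedP t x y :
  reflect (exists a b, [/\ a < b, subseq (inst a b (before3 t)) x &
             subseq (inst a b (after3 t)) y])
          (obstructed t x y).
Proof. by apply: blockedP; case: t. Qed.

Lemma inst_notin N a b s : a < b -> b < N -> N \notin inst a b s.
Proof. by move=> ab bN; apply/mapP => -[i _]; case: ifP; lia. Qed.

(** If the 3 of an occurrence is below N, neither copy of N is used. Otherwise the 3 is one of the
    two copies, and the other copy is skipped since the remaining letters are below N. *)
Lemma contains_insert t N x y z : {in x ++ y ++ z, forall a, a < N} ->
  contains t (x ++ N :: y ++ N :: z) =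
  [|| contains t (x ++ y ++ z), obstructed t x (y ++ z) | obstructed t (x ++ y) z].
Proof.
move=> ltN.
have [Nx Ny Nz] : [/\ N \notin x, N \notin y & N \notin z].
  by split; apply/negP => Nw; have := ltN N; rewrite !mem_cat Nw ?orbT ltnn; auto.
have subN s : N \notin s -> subseq s (x ++ N :: y ++ N :: z) = subseq s (x ++ y ++ z).
  by move=> sN; rewrite subseq_insert // catA subseq_insert // -catA.
have pivot s r : N \notin s -> N \notin r ->
    subseq (s ++ N :: r) (x ++ N :: y ++ N :: z) =
    subseq s x && subseq r (y ++ z) || subseq s (x ++ y) && subseq r z.
  move=> sN rN; rewrite subseq_pivot // catA subseq_split //; last first.
    by rewrite mem_cat negb_or Nx.
  by rewrite subseq_insert.
apply/containsP/or3P.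
  case=> a [b [c [ab bc abc]]].
  have cN : c <= N.
    have : c \in x ++ N :: y ++ N :: z.
      by apply: (mem_subseq abc); rewrite mem_cat mem_head orbT.
    rewrite mem_cat inE mem_cat inE => cw.
    case: (eqVneq c N) cw => [-> //|_] cw.
    by apply/ltnW/ltN; rewrite !mem_cat.
  case: (ltngtP c N) cN => // [cN _|cN _].
    apply: Or31; apply/containsP; exists a, b, c; split=> //.
    rewrite -subN // mem_cat inE !negb_or !(inst_notin _ ab) ?gtn_eqF //=; lia.
  subst c; rewrite pivot ?inst_notin // in abc.
  by case/orP: abc => /andP [h1 h2]; [apply: Or32 | apply: Or33];
    apply/obstructedP; exists a, b.
case=> [/containsP [a [b [c [ab bc abc]]]]|/obstructedP [a [b [ab h1 h2]]]|
        /obstructedP [a [b [ab h1 h2]]]].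
- exists a, b, c; split=> //; rewrite subN //.
  have cN : c < N by apply/ltN/(mem_subseq abc); rewrite mem_cat mem_head orbT.
  rewrite mem_cat inE !negb_or !(inst_notin _ ab) ?gtn_eqF //=; lia.
- have bN : b < N.
    apply: ltN; rewrite mem_cat (mem_subseq h1) //.
    by apply/mapP; exists 2 => //; case: t {h1 h2}.
  by exists a, b, N; split=> //; rewrite pivot ?inst_notin // h1 h2.
have bN : b < N.
  apply: ltN; rewrite catA mem_cat (mem_subseq h1) //.
  by apply/mapP; exists 2 => //; case: t {h1 h2}.
by exists a, b, N; split=> //; rewrite pivot ?inst_notin // h1 h2 orbT.
Qed.

(** Think of [X0] and [Y0] as [X] and [Y] with N deleted. Obstructions by old letters are unchanged;
    a new one must use N, which as the largest letter can only be the letter 2. *)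
Lemma obstructed_new t N x X Y X0 Y0 :
    (forall s, N \notin s -> subseq s X = subseq s X0) ->
    (forall s, N \notin s -> subseq s Y = subseq s Y0) ->
    {in X, forall a, a = N \/ a \in x} -> {subset X0 <= x} -> {in x, forall a, a < N} ->
  obstructed t X Y = obstructed t X0 Y0 ||
    has (fun a => subseq (inst a N (before3 t)) X && subseq (inst a N (after3 t)) Y) x.
Proof.
move=> subX subY memX memX0 ltN.
have sub12 a b Z : subseq (inst a b (before3 t)) Z -> (a \in Z) /\ (b \in Z).
  move/mem_subseq => sZ; split; apply: sZ; apply/mapP.
    by exists 1 => //; case: t.
  by exists 2 => //; case: t.
apply/obstructedP/orP => [[a [b [ab h1 h2]]]|].
  have [aX bX] := sub12 _ _ _ h1; case: (memX _ bX) => [bN|bx].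
    right; apply/hasP; exists a; last by rewrite -bN h1 h2.
    by case: (memX _ aX) => // aN; move: ab; rewrite aN bN ltnn.
  left; apply/obstructedP; exists a, b; have bN := ltN _ bx.
  by rewrite -subX ?inst_notin // -subY ?inst_notin.
case=> [/obstructedP [a [b [ab h1 h2]]]|/hasP [a ax /andP [h1 h2]]]; last first.
  by exists a, N; split=> //; apply: ltN.
have [_ /memX0 /ltN bN] := sub12 _ _ _ h1.
by exists a, b; rewrite subX ?inst_notin // subY ?inst_notin.
Qed.

(* The left part must contain every letter of the right part because the new
   letter may only be inserted after all first occurrences. *)
Definition open_gap t (x y : seq nat) : bool := all [in x] y && ~~ obstructed t x y.

(* The word x N y N z has new obstructions only with N as the letter 2.  Whether a
   gap of x y z stays open is decided below, for a gap splitting y = y1 y2, and by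
   [stays_open_after], for a gap splitting z = z1 z2. *)
Definition stays_open_inside t (y1 y2 z : seq nat) : bool :=
  match t with
  | P12312 => nilp y2
  | P12132 => nilp y1
  | P12321 => nilp z
  | _ => true
  end.

Definition stays_open_after t (y z1 z2 : seq nat) : bool :=
  match t with
  | P12123 => nilp y
  | P12231 => nilp z2
  | P12213 => nilp z1
  | _ => true
  end.

Lemma has_nilp (y x : seq nat) : {subset y <= x} -> has [in y] x = ~~ nilp y.
Proof.
case: y => [|a y] yx; first by apply/hasP => -[].
by apply/hasP; exists a; rewrite ?mem_head // yx ?mem_head.
Qed.

(** One N lies on each side of the gap, so patterns with two letters 2 before the 3 gain no
    obstruction. For the others, with N as 2, an old letter a obstructs iff it lies in [y2] (12312),
    [y1] (12132) or [z] (12321). As [x] contains every letter, such an a exists iff that factor is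
    nonempty. *)
Lemma open_gap_inside t N x y1 y2 z :
    {in x, forall a, a < N} -> {subset y1 ++ y2 ++ z <= x} ->
  open_gap t (x ++ N :: y1) (y2 ++ N :: z) =
  open_gap t (x ++ y1) (y2 ++ z) && stays_open_inside t y1 y2 z.
Proof.
move=> ltN yzx; rewrite /open_gap.
have y1x : {subset y1 <= x} by move=> a ay; apply: yzx; rewrite mem_cat ay.
have y2x : {subset y2 <= x} by move=> a ay; apply: yzx; rewrite !mem_cat ay orbT.
have zx : {subset z <= x} by move=> a az; apply: yzx; rewrite !mem_cat az !orbT.
have Nx : N \notin x by apply/negP => /ltN; rewrite ltnn.
have [Ny1 Ny2 Nz] : [/\ N \notin y1, N \notin y2 & N \notin z].
  by split; apply/negP; [move/y1x|move/y2x|move/zx]; apply/negP.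
have -> : all [in x ++ N :: y1] (y2 ++ N :: z).
  apply/allP => a; rewrite !mem_cat !inE => /or3P [/y2x ->|->|/zx ->] //.
  by rewrite orbT.
have -> : all [in x ++ y1] (y2 ++ z).
  by apply/allP => a; rewrite !mem_cat => /orP [/y2x ->|/zx ->].
rewrite (@obstructed_new t N x _ _ (x ++ y1) (y2 ++ z)) ?negb_or //; first last.
- by move=> a; rewrite mem_cat => /orP [//|/y1x].
- by move=> a; rewrite mem_cat inE => /or3P [->|/eqP->|/y1x ->]; [right|left|right].
- by move=> s sN; rewrite subseq_insert.
- by move=> s sN; rewrite subseq_insert.
rewrite /=; congr (_ && _); apply: negb_inj; rewrite negbK.
(* For each pattern, the condition for a to form an obstruction with N as the letter 2. *)
transitivity (has (fun a => match t with
  | P12312 => a \in y2 | P12132 => a \in y1 | P12321 => a \in z | _ => false end) x).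
  apply: eq_in_has => a ax.
  have aN : N \notin [:: a] by rewrite inE gtn_eqF // ltN.
  case: t => /=; rewrite ?(subseq_head2 _ _ Nx ax) ?sub0seq ?sub1seq /=.
  + by rewrite (@subseq_split _ _ [:: a]) // sub1seq sub0seq andbT.
  + by rewrite mem_cat mem_head orbT andbT.
  + by rewrite andbT (@subseqN _ N) // !inE eqxx orbT.
  + by rewrite subseq_head // sub1seq.
  + by rewrite (negPf Ny1).
  + by rewrite andbT (@subseqN _ N) // !inE eqxx.
by case: t => /=; rewrite ?has_nilp ?has_pred0 ?negbK.
Qed.

(** Both copies of N lie to the left, so patterns with a 2 after the 3 gain no obstruction. For the
    others an old letter a obstructs iff it lies in [y] (12123), [z2] (12231) or [z1] (12213). *)
Lemma open_gap_after t N x y z1 z2 :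
    {in x, forall a, a < N} -> {subset y ++ z1 ++ z2 <= x} ->
  open_gap t (x ++ N :: y ++ N :: z1) z2 =
  open_gap t (x ++ y ++ z1) z2 && stays_open_after t y z1 z2.
Proof.
move=> ltN yzx; rewrite /open_gap.
have yx : {subset y <= x} by move=> a ay; apply: yzx; rewrite mem_cat ay.
have z1x : {subset z1 <= x} by move=> a ay; apply: yzx; rewrite !mem_cat ay orbT.
have z2x : {subset z2 <= x} by move=> a az; apply: yzx; rewrite !mem_cat az !orbT.
have Nx : N \notin x by apply/negP => /ltN; rewrite ltnn.
have [Ny Nz1 Nz2] : [/\ N \notin y, N \notin z1 & N \notin z2].
  by split; apply/negP; [move/yx|move/z1x|move/z2x]; apply/negP.
have -> : all [in x ++ N :: y ++ N :: z1] z2.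
  by apply/allP => a /z2x ax; rewrite mem_cat ax.
have -> : all [in x ++ y ++ z1] z2.
  by apply/allP => a /z2x ax; rewrite mem_cat ax.
rewrite (@obstructed_new t N x _ _ (x ++ y ++ z1) z2) ?negb_or //; first last.
- by move=> a; rewrite !mem_cat => /or3P [//|/yx|/z1x].
- move=> a; rewrite mem_cat inE mem_cat inE.
  by case/orP=> [->|/or4P [/eqP->|/yx->|/eqP->|/z1x->]]; [right|left|right|left|right].
- by move=> s sN; rewrite subseq_insert // catA subseq_insert // -catA.
rewrite /=; congr (_ && _); apply: negb_inj; rewrite negbK.
transitivity (has (fun a => match t with
  | P12123 => a \in y | P12231 => a \in z2 | P12213 => a \in z1 | _ => false end) x).
  apply: eq_in_has => a ax.
  have aN : N \notin [:: a] by rewrite inE gtn_eqF // ltN.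
  case: t => /=; rewrite ?(subseq_head2 _ _ Nx ax) ?sub0seq ?sub1seq /= ?andbT.
  + by rewrite (@subseqN _ N) // !inE eqxx orbT.
  + by rewrite (negPf Nz2) andbF.
  + by rewrite (@subseq_split _ _ [:: a]) // sub1seq sub0seq andbT.
  + by rewrite (@subseqN _ N) // !inE eqxx.
  + by rewrite mem_cat mem_head orbT.
  + by rewrite subseq_head // sub1seq.
by case: t => /=; rewrite ?has_nilp ?has_pred0 ?negbK.
Qed.

(** * Gaps after an insertion *)

Definition insert_pair N p q (w : seq nat) : seq nat :=
  take p w ++ N :: drop p (take q w) ++ N :: drop q w.

Lemma cut_between p q (w : seq nat) : p <= q ->
  w = take p w ++ drop p (take q w) ++ drop q w.
Proof. by move=> pq; rewrite catA -(take_takel w pq) cat_take_drop cat_take_drop. Qed.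

Lemma drop_cut p q (w : seq nat) : p <= q -> drop p w = drop p (take q w) ++ drop q w.
Proof.
move=> /(cut_between w); rewrite -{1}(cat_take_drop p w) => /eqP.
by rewrite eqseq_cat // eqxx => /eqP.
Qed.

Definition gap t w p : bool := open_gap t (take p w) (drop p w).

Definition gaps t w : seq nat := [seq p <- iota 0 (size w).+1 | gap t w p].

Lemma mem_gaps t w p : (p \in gaps t w) = gap t w p && (p <= size w).
Proof. by rewrite mem_filter mem_iota. Qed.

Lemma gap_subset t w p : gap t w p -> {subset w <= take p w}.
Proof.
move=> /andP [/allP right_left _] a.
by rewrite -{1}(cat_take_drop p w) mem_cat => /orP [//|/right_left].
Qed.

(** Such a gap has N on its right but not on its left, so it precedes a first occurrence. *)
Lemma gap_insert_before t N (w : seq nat) p q x :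
  N \notin w -> x <= p -> p <= size w -> gap t (insert_pair N p q w) x = false.
Proof.
move=> Nw xp pw; apply/negP => /andP [/allP /(_ N)].
rewrite /insert_pair; set r := N :: _.
have sz : size (take p w) = p by rewrite size_takel.
rewrite take_cat drop_cat sz; case: ltnP => [xp'|px].
  rewrite mem_cat mem_head orbT take_takel // => /(_ isT) /mem_take Nw'.
  by rewrite Nw' in Nw.
have -> : x - p = 0 by lia.
rewrite drop0 take0 cats0 mem_head => /(_ isT) /mem_take Nw'.
by rewrite Nw' in Nw.
Qed.

(* [stays_open_inside] and [stays_open_after] in terms of gap positions, [m] being
   the size of the word. *)
Definition inside_ok t (m p q x : nat) : bool :=
  match t with
  | P12312 => x == q
  | P12132 => x == p
  | P12321 => q == m
  | _ => true
  end.

Definition after_ok t (m p q x : nat) : bool :=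
  match t with
  | P12123 => p == q
  | P12231 => x == m
  | P12213 => x == q
  | _ => true
  end.

Section InsertGaps.

Variables (t : pattern) (N : nat) (w : seq nat) (p q : nat).
Hypotheses (ltN : {in w, forall a, a < N}) (gap_p : gap t w p).
Hypotheses (pq : p <= q) (qw : q <= size w).

Let take_p_lt : {in take p w, forall a, a < N}.
Proof. by move=> a /mem_take /ltN. Qed.

(** A gap between the two copies of N shifts by one position, a gap after both by two. The gap q
    falls under both cases, since the second N splits it. *)
Lemma gap_insert_inside x : p <= x -> x <= q ->
  gap t (insert_pair N p q w) x.+1 = gap t w x && inside_ok t (size w) p q x.
Proof.
move=> px xq; set y1 := drop p (take x w); set y2 := drop x (take q w).
have wE : w = take p w ++ y1 ++ y2 ++ drop q w.
  rewrite {1}(cut_between w pq) (drop_cut (take q w) px) take_takel //.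
  by rewrite -/y1 -/y2 -catA.
have sub : {subset y1 ++ y2 ++ drop q w <= take p w}.
  by move=> a ay; apply: (gap_subset gap_p); rewrite wE mem_cat ay orbT.
have szp : size (take p w) = p by rewrite size_takel //; lia.
have sz1 : size y1 = x - p by rewrite size_drop size_takel //; lia.
have insE : insert_pair N p q w = (take p w ++ N :: y1) ++ (y2 ++ N :: drop q w).
  rewrite /insert_pair -catA cat_cons; congr (_ ++ _ :: _).
  rewrite catA; congr (_ ++ _).
  by rewrite (drop_cut (take q w) px) take_takel.
rewrite /gap insE take_size_cat ?drop_size_cat; try by rewrite size_cat /= szp sz1; lia.
rewrite open_gap_inside //; congr (_ && _).
  by congr open_gap; [rewrite -(take_takel w px) cat_take_drop | rewrite -drop_cut].
have sz2 : size y2 = q - x by rewrite size_drop size_takel //; lia.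
have sz3 : size (drop q w) = size w - q by rewrite size_drop.
by rewrite /stays_open_inside /inside_ok /nilp sz1 sz2 sz3; case: t => //; apply/eqP/eqP; lia.
Qed.

Lemma gap_insert_after x : q <= x -> x <= size w ->
  gap t (insert_pair N p q w) x.+2 = gap t w x && after_ok t (size w) p q x.
Proof.
move=> qx xw; set y := drop p (take q w); set z1 := drop q (take x w).
have wE : w = take p w ++ y ++ z1 ++ drop x w.
  by rewrite {1}(cut_between w pq) (drop_cut w qx).
have sub : {subset y ++ z1 ++ drop x w <= take p w}.
  by move=> a ay; apply: (gap_subset gap_p); rewrite wE mem_cat ay orbT.
have szp : size (take p w) = p by rewrite size_takel //; lia.
have sz1 : size y = q - p by rewrite size_drop size_takel //; lia.
have sz2 : size z1 = x - q by rewrite size_drop size_takel //; lia.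
have insE : insert_pair N p q w = (take p w ++ N :: y ++ N :: z1) ++ drop x w.
  rewrite /insert_pair -catA cat_cons -catA cat_cons; congr (_ ++ _ :: _ ++ _ :: _).
  exact: drop_cut.
rewrite /gap insE take_size_cat ?drop_size_cat;
  try by rewrite size_cat /= size_cat /= szp sz1 sz2; lia.
rewrite open_gap_after //; congr (_ && _).
  congr open_gap; rewrite catA -(take_takel w pq) cat_take_drop.
  by rewrite -(take_takel w qx) cat_take_drop.
have sz3 : size (drop x w) = size w - x by rewrite size_drop.
by rewrite /stays_open_after /after_ok /nilp sz1 sz2 sz3; case: t => //; apply/eqP/eqP; lia.
Qed.

Lemma size_gaps_insert :
  size (gaps t (insert_pair N p q w)) =
  count (fun x => [&& p <= x, x <= q & inside_ok t (size w) p q x]) (gaps t w) +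
  count (fun x => (q <= x) && after_ok t (size w) p q x) (gaps t w).
Proof.
have Nw : N \notin w by apply/negP => /ltN; rewrite ltnn.
have szI : size (insert_pair N p q w) = (size w).+2.
  have := congr1 size (cut_between w pq).
  by rewrite /insert_pair !size_cat /= size_cat /=; lia.
rewrite size_filter szI !count_filter.
(* The positions of the new word split into 0..p, all closed, then p + 1..q + 1 between the copies,
   then the rest. *)
have -> : (size w).+3 = p.+1 + ((q - p).+1 + (size w - q).+1) by lia.
rewrite iotaD iotaD !count_cat add0n.
rewrite (_ : count _ (iota 0 p.+1) = 0); last first.
  apply/eqP; rewrite -leqn0 leqNgt -has_count; apply/hasPn => x.
  by rewrite mem_iota => xp; rewrite gap_insert_before //; lia.
rewrite add0n -[p.+1]/(1 + p) iotaDl count_map.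
rewrite (_ : 1 + p + (q - p).+1 = 2 + q); last by lia.
rewrite iotaDl count_map; congr (_ + _).
  have -> : (size w).+1 = p + ((q - p).+1 + (size w - q)) by lia.
  rewrite [in RHS]iotaD iotaD !count_cat add0n [X in _ = X + _](_ : _ = 0); last first.
    apply/eqP; rewrite -leqn0 leqNgt -has_count; apply/hasPn => x /=.
    by rewrite mem_iota => /andP [_ xp]; rewrite leqNgt xp.
  rewrite [X in _ = _ + (_ + X)](_ : _ = 0); last first.
    apply/eqP; rewrite -leqn0 leqNgt -has_count; apply/hasPn => x /=.
    by rewrite mem_iota => /andP [qx _]; apply/negP => /andP [/and3P [_ xq _] _]; lia.
  rewrite addn0; apply: eq_in_count => x; rewrite mem_iota => xpq /=.
  by rewrite add1n gap_insert_inside; lia.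
have -> : (size w).+1 = q + (size w - q).+1 by lia.
rewrite [in RHS]iotaD count_cat add0n [X in _ = X + _](_ : _ = 0); last first.
  apply/eqP; rewrite -leqn0 leqNgt -has_count; apply/hasPn => x /=.
  by rewrite mem_iota => /andP [_ xq]; rewrite leqNgt xq.
apply: eq_in_count => x; rewrite mem_iota => xqw /=.
by rewrite add2n gap_insert_after; lia.
Qed.

End InsertGaps.

Lemma gaps_sorted t w : sorted ltn (gaps t w).
Proof. exact/(sorted_filter ltn_trans)/iota_ltn_sorted. Qed.

Lemma nth_gaps t w i : i < size (gaps t w) ->
  gap t w (nth 0 (gaps t w) i) /\ nth 0 (gaps t w) i <= size w.
Proof. by move=> iK; have := mem_nth 0 iK; rewrite mem_gaps => /andP. Qed.

Lemma sorted_ltn_nth_leq s i j : sorted ltn s -> i < size s -> j < size s ->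
  (nth 0 s i <= nth 0 s j) = (i <= j).
Proof.
move=> s_lt si sj; have mono := sorted_ltn_nth ltn_trans 0 s_lt.
case: (ltngtP i j) => [ij|ji|->]; last by rewrite leqnn.
  by rewrite ltnW // mono.
by apply/negbTE; rewrite -ltnNge mono.
Qed.

Lemma sorted_ltn_nth_eq s i j : sorted ltn s -> i < size s -> j < size s ->
  (nth 0 s i == nth 0 s j) = (i == j).
Proof. by move=> s_lt si sj; rewrite !eqn_leq !sorted_ltn_nth_leq. Qed.

Lemma count_nth_iota (P Q : pred nat) (s : seq nat) :
    (forall i, i < size s -> P (nth 0 s i) = Q i) ->
  count P s = count Q (iota 0 (size s)).
Proof.
move=> PQ; rewrite -{1}(mkseq_nth 0 s) count_map.
by apply: eq_in_count => i; rewrite mem_iota => /PQ.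
Qed.

Lemma count_interval a b K : a <= b -> b <= K ->
  count (fun x => a <= x < b) (iota 0 K) = b - a.
Proof.
move=> ab bK; have -> : K = a + ((b - a) + (K - b)) by lia.
rewrite iotaD iotaD !count_cat add0n.
rewrite (_ : count _ (iota 0 a) = 0); last first.
  apply/eqP; rewrite -leqn0 leqNgt -has_count; apply/hasPn => x.
  rewrite mem_iota; lia.
rewrite (_ : count _ (iota (a + _) _) = 0); last first.
  apply/eqP; rewrite -leqn0 leqNgt -has_count; apply/hasPn => x.
  rewrite mem_iota; lia.
rewrite add0n addn0 -[RHS](size_iota a); apply/eqP; rewrite -all_count.
by apply/allP => x; rewrite mem_iota; lia.
Qed.

Lemma gap_end t w : after3 t != [::] -> gap t w (size w).
Proof.
move=> vn; rewrite /gap take_size drop_size /open_gap /=.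
by apply/obstructedP => -[a [b [_ _]]]; case: (after3 t) vn.
Qed.

(** The end of the word is an open gap here, hence the one of highest rank. This turns the
    comparisons with m in [inside_ok] and [after_ok] into conditions on ranks. *)
Lemma last_gap t w i : after3 t != [::] -> i < size (gaps t w) ->
  (nth 0 (gaps t w) i == size w) = (i.+1 == size (gaps t w)).
Proof.
move=> vn iK; have mw : size w \in gaps t w by rewrite mem_gaps gap_end // leqnn.
have lt_last : index (size w) (gaps t w) < size (gaps t w) by rewrite index_mem.
rewrite -{1}(nth_index 0 mw) sorted_ltn_nth_eq ?gaps_sorted //.
suff : (size (gaps t w)).-1 <= index (size w) (gaps t w) by lia.
rewrite -(sorted_ltn_nth_leq (gaps_sorted t w)) //; last by lia.
by rewrite nth_index //; apply: (proj2 (nth_gaps _)); lia.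
Qed.

(* Number of open gaps after insertion at the open gaps of ranks i <= j among K. *)
Definition child_size t K i j : nat :=
  match t with
  | P12312 | P12132 => (K - j).+1
  | P12123 => if i == j then (K - j).+1 else (j - i).+1
  | P12321 => if j.+1 == K then (K - i).+1 else K - j
  | P12231 | P12213 => (j - i).+2
  end.

(** As [gaps] is increasing, comparisons of positions are comparisons of ranks, and each count in
    [size_gaps_insert] runs over an interval of ranks, possibly empty. *)
Lemma size_gaps_child t N (w : seq nat) i j (s := gaps t w) :
    {in w, forall a, a < N} -> i <= j -> j < size s ->
  size (gaps t (insert_pair N (nth 0 s i) (nth 0 s j) w)) = child_size t (size s) i j.
Proof.
move=> ltN ij jK; have s_lt := gaps_sorted t w; rewrite -/s in s_lt.
have iK : i < size s by lia.
have [[gi _] [_ jw]] := (nth_gaps iK, nth_gaps jK).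
rewrite size_gaps_insert // ?sorted_ltn_nth_leq // -/s.
rewrite (@count_nth_iota _ (fun x => [&& i <= x, x <= j & match t with
    | P12312 => x == j | P12132 => x == i | P12321 => j.+1 == size s
    | _ => true end])); last first.
  move=> x xK; rewrite /= !sorted_ltn_nth_leq //; congr [&& _, _ & _].
  case E: t => //=; rewrite ?sorted_ltn_nth_eq //.
  by rewrite /s last_gap // E.
rewrite [X in _ + X](@count_nth_iota _ (fun x => (j <= x) && match t with
    | P12123 => i == j | P12231 => x.+1 == size s | P12213 => x == j
    | _ => true end)); last first.
  move=> x xK; rewrite /= !sorted_ltn_nth_leq //; congr (_ && _).
  case E: t => //=; rewrite ?sorted_ltn_nth_eq //.
  by rewrite /s last_gap // E.
have cnt (P : pred nat) a b : a <= b -> b <= size s ->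
    (forall x, x < size s -> P x = (a <= x < b)) -> count P (iota 0 (size s)) = b - a.
  move=> ab bK PE; rewrite -(count_interval ab bK).
  by apply: eq_in_count => x; rewrite mem_iota => /PE.
case: t @s iK jK {gi jw s_lt} cnt => s iK jK cnt /=.
- rewrite (cnt _ j j.+1) ?(cnt _ j (size s)) //; lia.
- rewrite (cnt _ i i.+1) ?(cnt _ j (size s)) //; lia.
- rewrite (cnt _ i j.+1) //; try lia.
  case: eqP => [->|ne]; first by rewrite (cnt _ j (size s)) //; lia.
  rewrite (cnt _ 0 0) //; lia.
- rewrite [X in _ + X](cnt _ j (size s)) //; try lia.
  case: eqP => [e|ne]; first by rewrite (cnt _ i j.+1) //; lia.
  rewrite (cnt _ 0 0) //; lia.
- rewrite (cnt _ i j.+1) ?(cnt _ (size s).-1 (size s)) //; lia.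
- rewrite (cnt _ i j.+1) ?(cnt _ j j.+1) //; lia.
Qed.

(** * The generating tree *)

Definition index_pairs K : seq (nat * nat) :=
  [seq (i, j) | j <- index_iota 0 K, i <- index_iota 0 j.+1].

Lemma mem_index_pairs K i j : ((i, j) \in index_pairs K) = (i <= j < K).
Proof.
apply/allpairsPdep/idP => [[j' [i' []]]|ijK].
  by rewrite !mem_index_iota => jK ij [-> ->]; lia.
by exists j, i; rewrite !mem_index_iota; split=> //; lia.
Qed.

Lemma index_pairs_uniq K : uniq (index_pairs K).
Proof.
apply: allpairs_uniq_dep; first exact: iota_uniq.
  by move=> j _; apply: iota_uniq.
by move=> [j i] [j' i'] _ _ /= [-> ->].
Qed.

Lemma sum_index_pairs K (h : nat -> nat -> nat) :
  \sum_(ij <- index_pairs K) h ij.1 ij.2 = \sum_(j < K) \sum_(i < j.+1) h i j.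
Proof.
rewrite big_allpairs_dep /= big_mkord.
by apply: eq_bigr => j _; rewrite big_mkord.
Qed.

Lemma sum_rev K (g : nat -> nat) : \sum_(i < K) g (K - i) = \sum_(i < K) g i.+1.
Proof.
rewrite (reindex_inj rev_ord_inj) /=; apply: eq_bigr => i _.
by congr g; have := ltn_ord i; lia.
Qed.

Section TriangularSums.

Variable g : nat -> nat.

Lemma weighted_sumS K :
  \sum_(d < K.+1) (K.+1 - d) * g d = \sum_(d < K) (K - d) * g d + \sum_(d < K.+1) g d.
Proof.
rewrite (big_ord_recr K) [in RHS]big_ord_recr /= addnA -big_split /=; congr (_ + _).
  by apply: eq_bigr => d _; rewrite (subSn (ltnW (ltn_ord d))) mulSn addnC.
by rewrite subSnn mul1n.
Qed.

Lemma triangular_sum_const K :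
  \sum_(j < K) \sum_(i < j.+1) g (K - j) = \sum_(d < K) (K - d) * g d.+1.
Proof.
rewrite (reindex_inj rev_ord_inj) /=; apply: eq_bigr => j _.
rewrite sum_nat_const card_ord; have := ltn_ord j => jK.
by rewrite subnSK // subKn // ltnW.
Qed.

Lemma triangular_sum_diff K :
  \sum_(j < K) \sum_(i < j.+1) g (j - i) = \sum_(d < K) (K - d) * g d.
Proof.
elim: K => [|K IHK]; first by rewrite !big_ord0.
rewrite big_ord_recr /= IHK weighted_sumS; congr (_ + _).
rewrite (reindex_inj rev_ord_inj) /=; apply: eq_bigr => i _.
by congr g; have := ltn_ord i; lia.
Qed.

End TriangularSums.

(** The value d + 2 is taken by exactly K - d pairs. Four patterns depend on K - j or on j - i alone
    and follow from the triangular sums. For 12123 and 12321 a diagonal or a column is split off,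
    taking each value once, and a smaller triangle remains. *)
Lemma sum_child_size t K (g : nat -> nat) :
  \sum_(ij <- index_pairs K) g (child_size t K ij.1 ij.2) =
  \sum_(d < K) (K - d) * g d.+2.
Proof.
rewrite (sum_index_pairs K (fun i j => g (child_size t K i j))).
have const_case : \sum_(j < K) \sum_(i < j.+1) g (K - j).+1 =
    \sum_(d < K) (K - d) * g d.+2 := triangular_sum_const (fun d => g d.+1) K.
have diff_case : \sum_(j < K) \sum_(i < j.+1) g (j - i).+2 =
    \sum_(d < K) (K - d) * g d.+2 := triangular_sum_diff (fun d => g d.+2) K.
case: t => //=; case: K {const_case diff_case} => [|K]; rewrite ?big_ord0 //.
(* Pattern 12123: the diagonal i = j is split off. *)
- rewrite (weighted_sumS (fun d => g d.+2)).
  under eq_bigr => j _ do rewrite big_ord_recr /= eqxx.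
  rewrite big_split /= (sum_rev K.+1 (fun d => g d.+1)); congr (_ + _).
  rewrite big_ord_recl big_ord0 add0n -(triangular_sum_diff (fun d => g d.+2)).
  apply: eq_bigr => j _; rewrite lift0; apply: eq_bigr => i _ /=.
  have := ltn_ord i => ij; rewrite ltn_eqF // subSn //.
(* Pattern 12321: the last column, where j + 1 is the number of gaps, is split off. *)
- rewrite (weighted_sumS (fun d => g d.+2)) big_ord_recr /= eqxx.
  rewrite (sum_rev K.+1 (fun d => g d.+1)); congr (_ + _).
  rewrite -(triangular_sum_const (fun d => g d.+1)); apply: eq_bigr => j _.
  apply: eq_bigr => i _; have := ltn_ord j => jK.
  by rewrite eqSS ltn_eqF // subSn // ltnW.
Qed.

(** * Canonical words avoiding a pattern *)

(* The last clause says that first occurrences appear in increasing order. *)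
Definition canonical_word n (w : seq nat) : Prop :=
  [/\ size w = 2 * n, {in w, forall a, 0 < a <= n},
      forall a, 0 < a <= n -> count_mem a w = 2 &
      forall i a, 0 < a < nth 0 w i -> a \in take i w].

Lemma canonical_word_insert n (w : seq nat) p q :
    canonical_word n w -> p <= q -> q <= size w -> {subset w <= take p w} ->
  canonical_word n.+1 (insert_pair n.+1 p q w).
Proof.
move=> [szw rng cnt ord] pq qw wp.
have wE := cut_between w pq.
have sz : size (insert_pair n.+1 p q w) = (size w).+2.
  by have := congr1 size wE; rewrite /insert_pair !size_cat /= size_cat /=; lia.
have memI a : (a \in insert_pair n.+1 p q w) = (a == n.+1) || (a \in w).
  rewrite [in RHS]wE /insert_pair !mem_cat !inE mem_cat inE.
  by case: (a == n.+1); rewrite ?orbT ?orbF //= ?orbA.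
have cntI a : count_mem a (insert_pair n.+1 p q w) = 2 * (n.+1 == a) + count_mem a w.
  rewrite [in RHS]wE /insert_pair !count_cat /= count_cat /=; lia.
split.
- by rewrite sz szw; lia.
- by move=> a; rewrite memI => /orP [/eqP->|/rng]; lia.
- move=> a aN; rewrite cntI; case: eqP => [<-|ne].
    rewrite (count_memPn _) //; apply/negP => /rng; lia.
  by rewrite cnt //; lia.
move=> i a; have szp : size (take p w) = p by rewrite size_takel //; lia.
case: (ltnP i p) => ip.
  rewrite /insert_pair nth_cat take_cat szp ip nth_take // take_takel; last by lia.
  exact: ord.
move=> /andP [a0 ai].
(* Past the end [nth] returns 0, which exceeds no a. *)
have iI : i < size (insert_pair n.+1 p q w).
  by rewrite ltnNge; apply/negP => h; rewrite nth_default in ai.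
have := mem_nth 0 iI; rewrite memI => ai'.
have an : a <= n.
  case/orP: ai' => [/eqP e|/rng /andP [_]]; first by rewrite e in ai.
  exact/leq_trans/ltnW.
have aw : a \in w by rewrite -has_pred1 has_count cnt // a0.
rewrite /insert_pair take_cat szp ltnNge ip /= mem_cat wp //.
Qed.

Lemma two_occurrences (N : nat) (w : seq nat) : count_mem N w = 2 ->
  exists x y z, w = x ++ N :: y ++ N :: z /\ N \notin x ++ y ++ z.
Proof.
move=> cw; have /splitPr Nw : N \in w by rewrite -has_pred1 has_count cw.
case: Nw cw => x r; rewrite count_cat /= eqxx => cw.
have [Nx|Nx] := boolP (N \in x).
  case/splitPr: Nx cw => x1 x2; rewrite count_cat /= eqxx => cw.
  exists x1, x2, r; rewrite -catA cat_cons; split=> //.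
  by apply/count_memPn; rewrite !count_cat /=; lia.
have /splitPr Nr : N \in r by rewrite -has_pred1 has_count; move: cw; rewrite (count_memPn Nx) /=; lia.
case: Nr cw => y z; rewrite count_cat /= eqxx => cw.
by exists x, y, z; split=> //; apply/count_memPn; rewrite !count_cat /=; lia.
Qed.

Lemma insert_pairE N (x y z : seq nat) :
  insert_pair N (size x) (size x + size y) (x ++ y ++ z) = x ++ N :: y ++ N :: z.
Proof.
rewrite /insert_pair take_size_cat // [in take (_ + _) _]catA.
by rewrite take_size_cat ?size_cat // drop_size_cat // [in drop _ _]catA drop_size_cat ?size_cat.
Qed.

(** All smaller letters occur before the first n + 1, so the prefix [x] already contains every
    letter of the shortened word. *)
Lemma canonical_word_remove n w : canonical_word n.+1 w ->
  exists x y z, [/\ w = x ++ n.+1 :: y ++ n.+1 :: z, canonical_word n (x ++ y ++ z) &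
    {subset x ++ y ++ z <= x}].
Proof.
move=> [szw rng cnt ord].
have [x [y [z [wE Nxyz]]]] := two_occurrences (cnt n.+1 (leqnn _)).
have memw a : (a \in w) = (a == n.+1) || (a \in x ++ y ++ z).
  rewrite wE !mem_cat !inE mem_cat inE.
  by case: (a == n.+1); rewrite ?orbT ?orbF //= ?orbA.
have nthx : nth 0 w (size x) = n.+1 by rewrite wE nth_cat ltnn subnn.
have takex : take (size x) w = x by rewrite wE take_size_cat.
have small a : 0 < a <= n -> a \in x.
  by move=> an; rewrite -takex; apply: ord; rewrite nthx.
have rng' : {in x ++ y ++ z, forall a, 0 < a <= n}.
  move=> a aw; have := rng a; rewrite memw aw orbT => /(_ isT).
  by case: (eqVneq a n.+1) aw => [->|]; rewrite ?(negPf Nxyz) //; lia.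
exists x, y, z; split=> //; last by move=> a /rng' /small.
split=> //.
- by move: szw; rewrite wE !size_cat /= size_cat /=; lia.
- move=> a an; have := cnt a; rewrite wE !count_cat /= count_cat /=.
  rewrite (_ : n.+1 == a = false); last by apply/eqP; lia.
  by rewrite !add0n; apply; lia.
move=> i a; case: (ltnP i (size x)) => ix.
  by have := ord i a; rewrite wE !nth_cat !take_cat ix.
move=> /andP [a0 ai]; rewrite take_cat ltnNge ix /= mem_cat small //.
rewrite a0 /=; case: (ltnP i (size (x ++ y ++ z))) => [iw|wi].
  by have /rng' /andP [_] := mem_nth 0 iw; apply/leq_trans/ltnW.
by rewrite nth_default in ai.
Qed.

Fixpoint avoiders t n : seq (seq nat) :=
  if n is m.+1 then
    [seq insert_pair m.+1 (nth 0 (gaps t w) ij.1) (nth 0 (gaps t w) ij.2) w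
      | w <- avoiders t m, ij <- index_pairs (size (gaps t w))]
  else [:: [::]].

(** Induction on n: by [contains_insert], insertion preserves avoidance iff neither gap is
    obstructed, and [canonical_word_remove] shows that every canonical word arises by such an
    insertion. *)
Lemma mem_avoiders t n w :
  w \in avoiders t n <-> canonical_word n w /\ ~~ contains t w.
Proof.
elim: n w => [|n IHn] w.
  rewrite inE; split=> [/eqP->|[[/size0nil -> //]]].
  split; last by apply/containsP => -[a [b [c [_ _]]]]; case: (inst a b _).
  by split=> // [a|i a]; [lia|rewrite nth_nil andbF].
split=> [/allpairsPdep [w' [[i j] [/IHn [can av] /=]]]|].
  rewrite mem_index_pairs => /andP [ij jK] ->.
  have iK := leq_ltn_trans ij jK.
  have [[gi iw] [gj jw]] := (nth_gaps iK, nth_gaps jK).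
  have pq : nth 0 (gaps t w') i <= nth 0 (gaps t w') j.
    by rewrite sorted_ltn_nth_leq ?gaps_sorted.
  move: (nth 0 _ i) (nth 0 _ j) pq gi iw gj jw => p q pq gp pw gq qw.
  split; first exact: canonical_word_insert can pq qw (gap_subset gp).
  have wE := cut_between w' pq.
  rewrite /insert_pair contains_insert -?wE ?negb_or ?av; last first.
    by move=> a aw; case: can => _ /(_ a aw) /andP [].
  rewrite -(drop_cut w' pq) -{2}(take_takel w' pq) cat_take_drop.
  by case/andP: gp => _ ->; case/andP: gq.
move=> [/canonical_word_remove [x [y [z [wE can sub]]]]].
rewrite wE contains_insert; last by move=> a aw; case: can => _ /(_ a aw) /andP [].
rewrite !negb_or => /and3P [av bp bq].
have gp : size x \in gaps t (x ++ y ++ z).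
  rewrite mem_gaps /gap /open_gap take_size_cat // drop_size_cat // bp size_cat leq_addr !andbT.
  by apply/allP => a ayz; apply: sub; rewrite mem_cat ayz orbT.
have gq : size x + size y \in gaps t (x ++ y ++ z).
  rewrite mem_gaps /gap /open_gap catA take_size_cat ?drop_size_cat ?size_cat // bq leq_addr !andbT.
  by apply/allP => a az; rewrite mem_cat sub // !mem_cat az !orbT.
apply/allpairsPdep; exists (x ++ y ++ z).
exists (index (size x) (gaps t (x ++ y ++ z)), index (size x + size y) (gaps t (x ++ y ++ z))).
rewrite /= !nth_index // insert_pairE; split=> //; first exact/IHn.
rewrite mem_index_pairs index_mem gq andbT.
by rewrite -(sorted_ltn_nth_leq (gaps_sorted t (x ++ y ++ z))) ?index_mem // !nth_index // leq_addr.
Qed.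

(** Deleting N recovers the word, the first N gives p, and its distance to the second N gives q -
    p. *)
Lemma insert_pair_inj N (w w' : seq nat) p q p' q' :
    N \notin w -> N \notin w' -> p <= q -> q <= size w -> p' <= q' -> q' <= size w' ->
    insert_pair N p q w = insert_pair N p' q' w' ->
  [/\ w = w', p = p' & q = q'].
Proof.
have del (v : seq nat) r s : N \notin v -> r <= s ->
    filter (predC1 N) (insert_pair N r s v) = v.
  move=> Nv rs; rewrite /insert_pair !filter_cat /= filter_cat /= eqxx /=.
  rewrite -!filter_cat -cut_between //; apply/all_filterP/allP => a av /=.
  by apply: contraNneq Nv => <-.
have idx (v : seq nat) r s : N \notin v -> r <= s -> s <= size v ->
    index N (insert_pair N r s v) = r.
  move=> Nv rs sv; rewrite index_cat.
  have /negPf -> : N \notin take r v by apply: contraNN Nv; apply: mem_take.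
  by rewrite /= eqxx addn0 size_takel //; lia.
have idx2 (v : seq nat) r s : N \notin v -> r <= s -> s <= size v ->
    index N (drop r.+1 (insert_pair N r s v)) = s - r.
  move=> Nv rs sv; rewrite /insert_pair -cat_rcons drop_size_cat; last first.
    by rewrite size_rcons size_takel //; lia.
  rewrite index_cat.
  have /negPf -> : N \notin drop r (take s v).
    by apply: contraNN Nv => /mem_drop /mem_take.
  by rewrite /= eqxx addn0 size_drop size_takel.
move=> Nw Nw' pq qw pq' qw' e.
have ep : p = p' by rewrite -(idx w p q) // e idx.
split=> //; first by rewrite -(del w p q) // e del.
by have := idx2 w p q Nw pq qw; rewrite e {1}ep idx2 //; lia.
Qed.

Lemma avoiders_uniq t n : uniq (avoiders t n).
Proof.
elim: n => [|n IHn] //=; apply: allpairs_uniq_dep => // [w _|].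
  exact: index_pairs_uniq.
have fresh w : w \in avoiders t n -> n.+1 \notin w.
  by move=> /mem_avoiders [[_ rng _ _] _]; apply/negP => /rng; rewrite ltnn andbF.
move=> u1 u2 /allpairsPdep [w [[i j] [wA ijK ->]]] /allpairsPdep [w' [[i' j'] [wA' ijK' ->]]].
rewrite /= mem_index_pairs in ijK *; rewrite mem_index_pairs in ijK'.
have [[ij jK] [ij' jK']] := (andP ijK, andP ijK').
case/insert_pair_inj; rewrite ?fresh ?sorted_ltn_nth_leq ?gaps_sorted //; try lia.
- exact: (nth_gaps _).2.
- exact: (nth_gaps _).2.
move=> ew; subst w' => /eqP ei /eqP ej.
rewrite sorted_ltn_nth_eq ?gaps_sorted // in ei; try lia.
rewrite sorted_ltn_nth_eq ?gaps_sorted // in ej; try lia.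
by rewrite (eqP ei) (eqP ej).
Qed.

Lemma sum_avoidersS t n (g : nat -> nat) :
  \sum_(w <- avoiders t n.+1) g (size (gaps t w)) =
  \sum_(w <- avoiders t n)
    \sum_(d < size (gaps t w)) (size (gaps t w) - d) * g d.+2.
Proof.
rewrite big_allpairs_dep /= big_seq [RHS]big_seq; apply: eq_bigr => w wA.
rewrite -(sum_child_size t) big_seq [RHS]big_seq; apply: eq_bigr => -[i j].
rewrite mem_index_pairs => /andP [ij jK] /=; rewrite size_gaps_child //.
by case/mem_avoiders: wA => [[_ rng _ _] _] a /rng /andP [].
Qed.

(** An arbitrary weight [g] lets the induction absorb one level of the tree into the weight. After
    exchanging sums, the coefficient of each value of [g] is an instance of [raney_step2]. *)
Lemma sum_avoiders t n (g : nat -> nat) :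
  \sum_(w <- avoiders t n) g (size (gaps t w)) =
  \sum_(k < n.+1) raney (n - k) (2 * k) * g k.+1.
Proof.
elim: n g => [|n IHn] g.
  by rewrite big_seq1 big_ord1 mul1n; case: t.
rewrite sum_avoidersS (IHn (fun K => \sum_(d < K) (K - d) * g d.+2)).
(* The term k = 0 vanishes, since T^0 has no term in z^(n + 1). *)
rewrite [RHS]big_ord_recl muln0 subn0 [raney n.+1 0]/= mul0n add0n.
under eq_bigr => k _.
  rewrite big_distrr /=.
  rewrite (big_ord_widen n.+1 (fun d => raney (n - k) (2 * k) * ((k.+1 - d) * g d.+2))) //.
  over.
rewrite (exchange_big_dep xpredT) //; apply: eq_bigr => d _.
rewrite lift0 subSS mulnS (raney_step2 (n - d) (2 * d)) big_distrl /=.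
have dn := ltn_ord d.
rewrite -(big_mkord xpredT (fun t => t.+1 * raney (n - d - t) (2 * d + 2 * t) * g d.+2)).
rewrite -(big_mkord (fun k => d < k.+1) (fun k => raney (n - k) (2 * k) * ((k.+1 - d) * g d.+2))).
rewrite (big_cat_nat _ (n := d)) //=; last by lia.
rewrite big_nat_cond big_pred0 ?add0n; last by move=> k; lia.
(* Only the terms with k at least d survive; k is replaced by k + d. *)
rewrite -{1}[nat_of_ord d]add0n big_addn subSn; last by lia.
rewrite big_nat_cond [RHS]big_nat_cond; apply: eq_big => k; first by lia.
move=> _; rewrite (_ : (k + d).+1 - d = k.+1); last by lia.
rewrite (_ : n - (k + d) = n - d - k); last by lia.
rewrite (_ : 2 * (k + d) = 2 * d + 2 * k); last by lia.
by rewrite mulnA (mulnC k.+1).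
Qed.

Lemma size_avoiders t n : size (avoiders t n) = raney n 1.
Proof.
rewrite -sum1_size (sum_avoiders t n (fun=> 1)) (raney_step n 0).
by apply: eq_bigr => k _; rewrite muln1.
Qed.

(** * Matchings and canonical words *)

Lemma set_min_le m (B : {set 'I_m}) i : i \in B -> set_min B <= i.
Proof.
by move=> iB; rewrite /set_min -minEnat -leEnat; apply: (bigmin_inf i).
Qed.

Lemma set_min_mem m (B : {set 'I_m}) i : i \in B ->
  exists2 j, j \in B & set_min B = j.
Proof.
move=> iB; rewrite /set_min -minEnat.
have [k _|j jB ->] := @eq_bigmin _ _ _ m i [in B] (@nat_of_ord m) iB; last by exists j.
exact/ltnW/ltn_ord.
Qed.

Lemma count_mem_nth (m : nat) (w : seq nat) a : size w = m ->
  count_mem a w = #|[set i : 'I_m | nth 0 w i == a]|.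
Proof.
move=> szw; rewrite -sum1_count (big_nth 0) szw big_mkord.
by rewrite -sum1_card; apply: eq_bigl => i; rewrite inE.
Qed.

Section CanonicalForm.

Variables (n : nat) (M : {set {set 'I_(2 * n)}}).
Hypothesis matching_M : is_matching M.

Let M_partition : partition M setT. Proof. by case/andP: matching_M. Qed.

Let M_trivI : trivIset M. Proof. by case/and3P: M_partition. Qed.

Let card2 B : B \in M -> #|B| = 2.
Proof. by case/andP: matching_M => _ /forallP /(_ B) /implyP h /h /eqP. Qed.

Let cardM : #|M| = n.
Proof.
have := card_uniform_partition card2 M_partition.
by rewrite cardsT card_ord; lia.
Qed.

Let mem_pblockM i : i \in pblock M i.
Proof. by rewrite mem_pblock (cover_partition M_partition) inE. Qed.

Let pblockM i : pblock M i \in M.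
Proof. by rewrite pblock_mem // (cover_partition M_partition) inE. Qed.

Let pblock_eq B i : B \in M -> i \in B -> pblock M i = B.
Proof. exact: def_pblock. Qed.

Let min_mem B : B \in M -> exists2 j, j \in B & set_min B = j.
Proof.
move=> BM; have /set0Pn [i iB] : B != set0 by rewrite -card_gt0 card2.
exact: set_min_mem iB.
Qed.

Let set_min_inj : {in M &, injective (@set_min (2 * n))}.
Proof.
move=> B B' BM BM'; have [j jB ->] := min_mem BM; have [j' jB' ->] := min_mem BM'.
by move=> /val_inj e; rewrite -(pblock_eq BM jB) -(pblock_eq BM' jB') e.
Qed.

Let label_lt B B' : B' \in M -> set_min B < set_min B' ->
  edge_label M B < edge_label M B'.
Proof.
move=> BM' lt; apply: proper_card; apply/properP; split.
  apply/subsetP => C; rewrite !inE => /andP [-> /=] CB.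
  exact: leq_trans CB (ltnW lt).
by exists B'; rewrite !inE BM' ?leqnn //= -ltnNge.
Qed.

Let label_inj : {in M &, injective (edge_label M)}.
Proof.
move=> B B' BM BM' e; apply: set_min_inj => //.
by case: (ltngtP (set_min B) (set_min B')) => // lt;
  [have := label_lt BM' lt | have := label_lt BM lt]; rewrite e ltnn.
Qed.

Let label_bounds B : B \in M -> 0 < edge_label M B <= n.
Proof.
move=> BM; apply/andP; split.
  by apply/card_gt0P; exists B; rewrite inE BM leqnn.
rewrite -[X in _ <= X]cardM; apply: subset_leq_card.
by apply/subsetP => C; rewrite inE => /andP [].
Qed.

(** The n edges have distinct labels in 1..n, so every label is taken. *)
Let label_onto a : 0 < a <= n -> exists2 B, B \in M & edge_label M B = a.
Proof.
move=> an; have u : uniq (map (edge_label M) (enum M)).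
  rewrite map_inj_in_uniq ?enum_uniq // => B B'.
  by rewrite !mem_enum; apply: label_inj.
have sub : {subset map (edge_label M) (enum M) <= iota 1 n}.
  move=> b /mapP [B]; rewrite mem_enum => /label_bounds bn ->.
  by rewrite mem_iota; lia.
have [|_ mem] := uniq_min_size u sub; first by rewrite size_map size_iota -cardE cardM.
have : a \in iota 1 n by rewrite mem_iota; lia.
by rewrite -mem => /mapP [B]; rewrite mem_enum => BM ->; exists B.
Qed.

Lemma size_canonical_form : size (canonical_form M) = 2 * n.
Proof. by rewrite size_map size_enum_ord. Qed.

Lemma nth_canonical_form (i : 'I_(2 * n)) :
  nth 0 (canonical_form M) i = edge_label M (pblock M i).
Proof. by rewrite (nth_map i) ?size_enum_ord // nth_ord_enum. Qed.

Lemma canonical_form_word : canonical_word n (canonical_form M).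
Proof.
split; first exact: size_canonical_form.
- by move=> a /mapP [i _ ->]; apply: label_bounds.
- move=> a /label_onto [B BM <-]; rewrite (count_mem_nth _ size_canonical_form).
  rewrite -[RHS](card2 BM); apply: eq_card => i.
  rewrite inE nth_canonical_form (inj_in_eq label_inj) //.
  by apply/eqP/idP => [<- //|/(pblock_eq BM)].
move=> i a /andP [a0 ai].
have iw : i < 2 * n.
  by rewrite ltnNge; apply/negP => h; rewrite nth_default ?size_canonical_form in ai.
rewrite (nth_canonical_form (Ordinal iw)) in ai.
have /andP [_ le_n] := label_bounds (pblockM (Ordinal iw)).
have [|B BM Ba] := @label_onto a; first by rewrite a0 (leq_trans (ltnW ai)).
have [j jB Bj] := min_mem BM.
(* Otherwise the block of i would have a minimum at most j = [set_min B], hence a label at most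
   a. *)
have ji : j < i.
  rewrite ltnNge; apply/negP => ij; move: ai; rewrite -Ba ltnNge => /negP; apply.
  have le : set_min (pblock M (Ordinal iw)) <= set_min B.
    by rewrite Bj; apply: leq_trans ij; apply: set_min_le (mem_pblockM (Ordinal iw)).
  apply: subset_leq_card; apply/subsetP => C; rewrite !inE => /andP [-> h].
  exact: leq_trans h le.
have -> : a = nth 0 (take i (canonical_form M)) j.
  by rewrite nth_take // nth_canonical_form (pblock_eq BM jB).
by apply: mem_nth; rewrite size_takel ?size_canonical_form // ltnW.
Qed.

Lemma eq_canonical_form (i j : 'I_(2 * n)) :
  (nth 0 (canonical_form M) i == nth 0 (canonical_form M) j) =
  (pblock M i == pblock M j).
Proof. by rewrite !nth_canonical_form (inj_in_eq label_inj). Qed.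

(** The edges are the classes of positions carrying equal letters, so the canonical form determines
    the matching. *)
Lemma matching_of_canonical_form :
  M = preim_partition (fun i : 'I_(2 * n) => nth 0 (canonical_form M) i) setT.
Proof.
rewrite -{1}(preim_partition_pblock M_partition).
rewrite /preim_partition /equivalence_partition; apply: eq_imset => i.
by apply/setP => j; rewrite !inE eq_canonical_form.
Qed.

End CanonicalForm.

(** Strong induction on the position. If the letters at i differ, the smaller one occurs earlier in
    the other word, hence in the common prefix; the shared equality pattern then forces the letters
    at i to agree. *)
Lemma canonical_word_kernel_inj n w w' :
    canonical_word n w -> canonical_word n w' ->
    (forall i j, i < 2 * n -> j < 2 * n ->
       (nth 0 w i == nth 0 w j) = (nth 0 w' i == nth 0 w' j)) ->
  w = w'.
Proof.
move=> [szw rng _ ord] [szw' rng' _ ord'] ker.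
apply: (@eq_from_nth _ 0) => [|i]; first by rewrite szw szw'.
rewrite szw; elim/ltn_ind: i => i IHi iw.
have take_eq : take i w = take i w'.
  apply: (@eq_from_nth _ 0); first by rewrite !size_takel ?szw ?szw' // ltnW.
  move=> j; rewrite size_takel ?szw ?(ltnW iw) // => ji.
  by rewrite !nth_take // IHi // (ltn_trans ji).
have old v v' : size v = 2 * n -> size v' = 2 * n -> take i v = take i v' ->
    (forall j, j < 2 * n -> (nth 0 v i == nth 0 v j) = (nth 0 v' i == nth 0 v' j)) ->
    nth 0 v i \in take i v -> nth 0 v i = nth 0 v' i.
  move=> szv szv' e k /(nthP 0) [j]; rewrite size_takel ?szv ?(ltnW iw) // => ji vj.
  have := k j (ltn_trans ji iw).
  rewrite -(nth_take 0 ji v) -(nth_take 0 ji v') -e vj eqxx => /esym /eqP ->.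
  by [].
case: (ltngtP (nth 0 w i) (nth 0 w' i)) => // lt.
  apply: (old w w') => // [j jw|]; first exact: ker.
  rewrite take_eq; apply: ord'; rewrite lt andbT.
  by have /rng /andP [] := mem_nth 0 (eq_ind_r (fun m => i < m) iw szw).
apply/esym; apply: (old w' w) => // [j jw|]; first by rewrite ker.
rewrite -take_eq; apply: ord; rewrite lt andbT.
by have /rng' /andP [] := mem_nth 0 (eq_ind_r (fun m => i < m) iw szw').
Qed.

(** The positions are grouped by letter. The canonical form of this matching has the same equality
    pattern as [w], hence equals [w]. *)
Lemma canonical_word_matching n w : canonical_word n w ->
  exists2 M : {set {set 'I_(2 * n)}}, is_matching M & canonical_form M = w.
Proof.
move=> can; have [szw rng cnt ord] := can.
pose f (i : 'I_(2 * n)) := nth 0 w i.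
have eqR : {in setT & &, equivalence_rel (fun i j : 'I_(2 * n) => f i == f j)}.
  by move=> i j k _ _ _; split=> // /eqP ->.
have matchM : is_matching (preim_partition f setT).
  apply/andP; split; first exact: preim_partitionP.
  apply/forallP => B; apply/implyP => /imsetP [i _ ->].
  apply/eqP; rewrite -[RHS](cnt (f i)); last by apply/rng/mem_nth; rewrite szw.
  rewrite (count_mem_nth _ szw); apply: eq_card => j.
  by rewrite !inE eq_sym.
exists (preim_partition f setT) => //.
apply: (canonical_word_kernel_inj (canonical_form_word matchM) can) => i j iw jw.
have part := preim_partitionP f [set: 'I_(2 * n)].
rewrite (eq_canonical_form matchM (Ordinal iw) (Ordinal jw)) eq_pblock.
- exact: pblock_equivalence_partition.
- by case/and3P: part.
- by rewrite (cover_partition part) inE.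
Qed.

Lemma card_avoiding_matchings t n :
  #|avoiding_matchings n (before3 t ++ 3 :: after3 t)| = size (avoiders t n).
Proof.
rewrite cardE -(size_map (@canonical_form (2 * n))); apply/perm_size/uniq_perm.
- rewrite map_inj_in_uniq ?enum_uniq // => M M'; rewrite !mem_enum !inE.
  move=> /andP [mM _] /andP [mM' _] e.
  by rewrite (matching_of_canonical_form mM) e -matching_of_canonical_form.
- exact: avoiders_uniq.
move=> w; apply/mapP/idP => [[M]|].
  rewrite mem_enum inE => /andP [mM av] ->.
  by apply/mem_avoiders; split=> //; apply: canonical_form_word.
case/mem_avoiders => /canonical_word_matching [M mM <-] av.
by exists M => //; rewrite mem_enum inE mM.
Qed.

Theorem theorem6 (tau : seq nat) (n : nat) :
  tau \in [:: [:: 1; 2; 3; 1; 2]; [:: 1; 2; 1; 3; 2]; [:: 1; 2; 1; 2; 3];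
              [:: 1; 2; 3; 2; 1]; [:: 1; 2; 2; 3; 1]; [:: 1; 2; 2; 1; 3]] ->
  1 <= n ->
  (#|avoiding_matchings n tau|%:R = 1 / (2 * n + 1)%N%:R * 'C(3 * n, n)%:R :> rat)%R.
Proof.
move=> tau_in _.
have [t ->] : exists t, tau = before3 t ++ 3 :: after3 t.
  move: tau_in; rewrite !inE => /or4P [/eqP->|/eqP->|/eqP->|/or3P [/eqP->|/eqP->|/eqP->]].
  - by exists P12312.
  - by exists P12132.
  - by exists P12123.
  - by exists P12321.
  - by exists P12231.
  - by exists P12213.
rewrite card_avoiding_matchings size_avoiders -raney1 GRing.natrM GRing.mulrA.
rewrite GRing.mul1r GRing.mulVf ?GRing.mul1r //.
by rewrite Num.Theory.pnatr_eq0 addn1.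
Qed.
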